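(* Every closed formula $\varphi\in\mathrm{cHML}^d$ is completely monitorable for satisfactions, and every closed formula $\varphi\in\mathrm{sHML}^d$ is completely monitorable for violations.
   Context: **Data and traces.** Fix a countably infinite set $\mathbb{D}$ (data values) whose only predicate is equality, which is decidable. $\mathrm{Trc}=\mathbb{D}^\omega$ is the set of traces, $\mathbb{D}^*$ the set of finite traces. **Logic $\mu\mathrm{HML}^d$.** Let $\mathrm{DVar}$ and $\mathrm{FVar}$ be countably infinite sets of data variables $x$ and recursion variables $X$; $\star\notin\mathrm{DVar}$ is a placeholder for the current data value. Constraint expressions: $b::=\mathsf{true}\mid e=f\mid\neg b\mid b\wedge b$, with $e,f\in\mathrm{DVar}\cup\{\star\}$. Formulae: $\varphi::=\mathsf{tt}\mid\mathsf{ff}\mid\langle b\rangle\varphi\mid[b]\varphi\mid\exists x.\varphi\mid\forall x.\varphi\mid\varphi\vee\varphi\mid\varphi\wedge\varphi\mid\min X.\varphi\mid\max X.\varphi\mid X$. A data environment $\delta$ is a partial function $\mathrm{DVar}\rightharpoonup\mathbb{D}$ with finite domain; a data interpretation $F$ maps data environments to subsets of $\mathrm{Trc}$, ordered by $F\sqsubseteq G$ iff $F(\delta)\subseteq G(\delta)$ for all $\delta$; a trace environment $\rho$ maps recursion variables to data interpretations. Semantics $[\![\varphi,\rho,\delta]\!]\subseteq\mathrm{Trc}$ (with $\delta$ defined on the free data variables of $\varphi$): $\mathsf{tt}\mapsto\mathrm{Trc}$; $\mathsf{ff}\mapsto\varnothing$; $[\![X,\rho,\delta]\!]=\rho(X)(\delta)$;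 $[\![\langle b\rangle\varphi,\rho,\delta]\!]=\{du\mid b\text{ true under }\delta[\star\mapsto d]\text{ and }u\in[\![\varphi,\rho,\delta]\!]\}$; $[\![[b]\varphi,\rho,\delta]\!]=\{du\mid b\text{ true under }\delta[\star\mapsto d]\text{ implies }u\in[\![\varphi,\rho,\delta]\!]\}$; $[\![\exists x.\varphi,\rho,\delta]\!]=\bigcup_{d\in\mathbb{D}}[\![\varphi,\rho,\delta[x\mapsto d]]\!]$; $[\![\forall x.\varphi,\rho,\delta]\!]=\bigcap_{d\in\mathbb{D}}[\![\varphi,\rho,\delta[x\mapsto d]]\!]$; $\vee,\wedge$ are union, intersection; $[\![\min X.\varphi,\rho,\delta]\!]$ (resp. $\max$) is the value at $\delta$ of the $\sqsubseteq$-least (resp. greatest) fixed point of $F\mapsto\lambda\delta'.[\![\varphi,\rho[X\mapsto F],\delta']\!]$. For closed $\varphi$ write $[\![\varphi]\!]$. Standing assumption: each occurrence of a recursion variable is in the scope of a modality inside its defining fixed-point formula. **Fragments.** $\mathrm{cHML}^d$: $\varphi::=\mathsf{tt}\mid\langle b\rangle\varphi\mid\exists x.\varphi\mid\varphi\vee\varphi\mid\varphi\wedge\varphi\mid\min X.\varphi\mid X$. $\mathrm{sHML}^d$: $\varphi::=\mathsf{ff}\mid[b]\varphi\mid\forall x.\varphi\mid\varphi\vee\varphi\mid\varphi\wedge\varphi\mid\max X.\varphi\mid X$. **Monitors.** A monitor is an object $m$ with predicates $\mathbf{acc}(m,w)$, $\mathbf{rej}(m,w)$ on $w\in\mathbb{D}^*$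 such that no $w$ satisfies both, and both are preserved when $w$ is extended to a longer finite trace. For $t\in\mathrm{Trc}$, $\mathbf{acc}(m,t)$ (resp. $\mathbf{rej}(m,t)$) holds iff it holds for some finite prefix of $t$. A formula $\varphi$ is completely monitorable for satisfactions if there is a monitor $m$ such that for all $t\in\mathrm{Trc}$, $\mathbf{acc}(m,t)\Leftrightarrow t\in[\![\varphi]\!]$; it is completely monitorable for violations if there is a monitor $m$ such that for all $t$, $\mathbf{rej}(m,t)\Leftrightarrow t\notin[\![\varphi]\!]$. *)

(* Defs.v *)
From mathcomp Require Import all_boot finmap.
From mathcomp Require Import boolp classical_sets.

Set Implicit Arguments.
Unset Strict Implicit.
Unset Printing Implicit Defensive.

Local Open Scope classical_set_scope.

Definition countably_infinite (T : Type) : Prop :=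
  exists f : nat -> T, bijective f.

Definition trace (D : Type) : Type := nat -> D.

Definition ttail (D : Type) (t : trace D) : trace D := fun n => t n.+1.

Inductive dterm (DVar : Type) : Type :=
  | Star
  | DV of DVar.

Arguments Star {DVar}.

Inductive constraint (DVar : Type) : Type :=
  | CTrue
  | CEq of dterm DVar & dterm DVar
  | CNot of constraint DVar
  | CAnd of constraint DVar & constraint DVar.

Arguments CTrue {DVar}.

Inductive formula (DVar FVar : Type) : Type :=
  | Tt
  | Ff
  | Dia of constraint DVar & formula DVar FVar
  | Box of constraint DVar & formula DVar FVar
  | Ex of DVar & formula DVar FVar
  | All of DVar & formula DVar FVar
  | Or of formula DVar FVar & formula DVar FVar
  | And of formula DVar FVar & formula DVar FVar
  | Min of FVar & formula DVar FVar
  | Max of FVar & formula DVar FVar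
  | RV of FVar.

Arguments Tt {DVar FVar}.
Arguments Ff {DVar FVar}.

Section Variables.
Local Open Scope fset_scope.
Variables DVar FVar : choiceType.

Definition dterm_vars (e : dterm DVar) : {fset DVar} :=
  if e is DV x then [fset x] else fset0.

Fixpoint constraint_vars (b : constraint DVar) : {fset DVar} :=
  match b with
  | CTrue => fset0
  | CEq e f => dterm_vars e `|` dterm_vars f
  | CNot b => constraint_vars b
  | CAnd b c => constraint_vars b `|` constraint_vars c
  end.

Fixpoint free_dvars (phi : formula DVar FVar) : {fset DVar} :=
  match phi with
  | Tt | Ff | RV _ => fset0
  | Dia b phi | Box b phi => constraint_vars b `|` free_dvars phi
  | Ex x phi | All x phi => free_dvars phi `\ x
  | Or phi psi | And phi psi => free_dvars phi `|` free_dvars psi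
  | Min _ phi | Max _ phi => free_dvars phi
  end.

Fixpoint free_fvars (phi : formula DVar FVar) : {fset FVar} :=
  match phi with
  | Tt | Ff => fset0
  | RV X => [fset X]
  | Dia _ phi | Box _ phi | Ex _ phi | All _ phi => free_fvars phi
  | Or phi psi | And phi psi => free_fvars phi `|` free_fvars psi
  | Min X phi | Max X phi => free_fvars phi `\ X
  end.

Definition closed_formula (phi : formula DVar FVar) : bool :=
  (free_dvars phi == fset0) && (free_fvars phi == fset0).

(** Every free occurrence of [X] in the formula lies under a modality. *)
Fixpoint guarded_in (X : FVar) (phi : formula DVar FVar) : bool :=
  match phi with
  | Tt | Ff | Dia _ _ | Box _ _ => true
  | RV Y => Y != X
  | Ex _ phi | All _ phi => guarded_in X phi
  | Or phi psi | And phi psi => guarded_in X phi && guarded_in X psi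
  | Min Y phi | Max Y phi => (Y == X) || guarded_in X phi
  end.

Fixpoint guarded_formula (phi : formula DVar FVar) : bool :=
  match phi with
  | Tt | Ff | RV _ => true
  | Dia _ phi | Box _ phi | Ex _ phi | All _ phi => guarded_formula phi
  | Or phi psi | And phi psi => guarded_formula phi && guarded_formula psi
  | Min X phi | Max X phi => guarded_in X phi && guarded_formula phi
  end.

End Variables.

Fixpoint cHML (DVar FVar : Type) (phi : formula DVar FVar) : bool :=
  match phi with
  | Tt | RV _ => true
  | Dia _ phi | Ex _ phi | Min _ phi => cHML phi
  | Or phi psi | And phi psi => cHML phi && cHML psi
  | Ff | Box _ _ | All _ _ | Max _ _ => false
  end.

Fixpoint sHML (DVar FVar : Type) (phi : formula DVar FVar) : bool :=
  match phi with
  | Ff | RV _ => true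
  | Box _ phi | All _ phi | Max _ phi => sHML phi
  | Or phi psi | And phi psi => sHML phi && sHML psi
  | Tt | Dia _ _ | Ex _ _ | Min _ _ => false
  end.

Section Semantics.
Local Open Scope fmap_scope.
Variables (D : eqType) (DVar FVar : choiceType).

Definition denv : Type := {fmap DVar -> D}.
Definition dinterp : Type := denv -> set (trace D).
Definition tenv : Type := FVar -> dinterp.

Definition dinterp_le (F G : dinterp) : Prop :=
  forall delta, F delta `<=` G delta.

Definition is_lfp (Phi : dinterp -> dinterp) (F : dinterp) : Prop :=
  Phi F = F /\ forall G, Phi G = G -> dinterp_le F G.

Definition is_gfp (Phi : dinterp -> dinterp) (F : dinterp) : Prop :=
  Phi F = F /\ forall G, Phi G = G -> dinterp_le G F.

(** Value of a term under [delta] with the current data value [d] for the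
    placeholder.  [None] arises only for variables outside the domain of
    [delta]; the semantics of a formula is meant to be used only when [delta]
    is defined on its free data variables, where this never happens. *)
Definition dterm_eval (delta : denv) (d : D) (e : dterm DVar) : option D :=
  match e with
  | Star => Some d
  | DV x => delta.[? x]
  end.

Fixpoint holds (delta : denv) (d : D) (b : constraint DVar) : bool :=
  match b with
  | CTrue => true
  | CEq e f => dterm_eval delta d e == dterm_eval delta d f
  | CNot b => ~~ holds delta d b
  | CAnd b c => holds delta d b && holds delta d c
  end.

(** At a fixed point formula, "[exists F, is_lfp _ F /\ F delta t]" says that
    [t] belongs to the value at [delta] of the (necessarily unique) least
    fixed point. *)
Fixpoint sem (phi : formula DVar FVar) (rho : tenv) (delta : denv) :
    set (trace D) :=
  match phi with
  | Tt => setT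
  | Ff => set0
  | Dia b phi =>
      [set t | holds delta (t 0) b /\ sem phi rho delta (ttail t)]
  | Box b phi =>
      [set t | holds delta (t 0) b -> sem phi rho delta (ttail t)]
  | Ex x phi => \bigcup_(d : D) sem phi rho delta.[x <- d]
  | All x phi => \bigcap_(d : D) sem phi rho delta.[x <- d]
  | Or phi psi => sem phi rho delta `|` sem psi rho delta
  | And phi psi => sem phi rho delta `&` sem psi rho delta
  | Min X phi =>
      [set t | exists F : dinterp,
         is_lfp (fun F' => sem phi [eta rho with X |-> F']) F /\ F delta t]
  | Max X phi =>
      [set t | exists F : dinterp,
         is_gfp (fun F' => sem phi [eta rho with X |-> F']) F /\ F delta t]
  | RV X => rho X delta
  end.

(** The semantics of a closed formula does not depend on the environments;
    arbitrary ones are chosen here. *)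
Definition sem_closed (phi : formula DVar FVar) : set (trace D) :=
  sem phi (fun _ _ => set0) [fmap].

End Semantics.

Record monitor (D : Type) : Type := Monitor {
  acc : seq D -> Prop;
  rej : seq D -> Prop;
  acc_rejN : forall w, ~ (acc w /\ rej w);
  acc_cat : forall w w', acc w -> acc (w ++ w');
  rej_cat : forall w w', rej w -> rej (w ++ w')
}.

Definition acc_trace (D : Type) (m : monitor D) (t : trace D) : Prop :=
  exists n, acc m (mkseq t n).

Definition rej_trace (D : Type) (m : monitor D) (t : trace D) : Prop :=
  exists n, rej m (mkseq t n).

Definition monitorable_for_satisfactions (D : eqType) (DVar FVar : choiceType)
    (phi : formula DVar FVar) : Prop :=
  exists m : monitor D, forall t : trace D,
    acc_trace m t <-> sem_closed phi t.

Definition monitorable_for_violations (D : eqType) (DVar FVar : choiceType)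
    (phi : formula DVar FVar) : Prop :=
  exists m : monitor D, forall t : trace D,
    rej_trace m t <-> ~ sem_closed phi t.

(* Main.v *)
Require Import Defs.
From mathcomp Require Import all_boot.
From mathcomp Require Import boolp classical_sets.

(** An arbitrary monitor may accept a finite trace as soon as all its infinite
    extensions satisfy the formula, so it suffices that the semantics of
    [cHML] formulae is open for the prefix topology, and that of [sHML]
    formulae closed.  All operators of [cHML] visibly preserve openness, except
    the least fixed point.  For the latter, the interior [F°] of the least
    fixed point [F] of [Phi] satisfies [Phi F° <= Phi F = F] and [Phi F°] is
    open, so [Phi F° <= F°] and hence [F <= F°].  The case of [sHML] is dual,
    with the closure of the greatest fixed point. *)

Set Implicit Arguments.
Unset Strict Implicit.
Unset Printing Implicit Defensive.

Local Open Scope classical_set_scope.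

Section PrefixTopology.
Variable D : Type.
Implicit Types (A B : set (trace D)) (t u : trace D).

Definition tinterior A : set (trace D) :=
  [set t | exists n, forall u, mkseq u n = mkseq t n -> A u].

(** Closure and closedness are given through complements, so that every fact about them reduces to
    one about open sets. *)
Definition tclosure A : set (trace D) := ~` tinterior (~` A).

Definition topen A := A `<=` tinterior A.

Definition tclosed A := topen (~` A).

Lemma mkseq_le t u m n : m <= n -> mkseq u n = mkseq t n ->
  mkseq u m = mkseq t m.
Proof.
move=> mn /(congr1 (take m)).
by rewrite /mkseq -!map_take !take_iota (minn_idPl mn).
Qed.

Lemma mkseq_ttail t u n : mkseq u n.+1 = mkseq t n.+1 ->
  u 0 = t 0 /\ mkseq (ttail u) n = mkseq (ttail t) n.
Proof.
by rewrite /mkseq /= -[1]addn0 iotaDl -!map_comp => -[-> e]; split.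
Qed.

Lemma tinterior_sub A : tinterior A `<=` A.
Proof. by move=> t [n]; apply. Qed.

Lemma tinteriorS A B : A `<=` B -> tinterior A `<=` tinterior B.
Proof. by move=> AB t [n nA]; exists n => u /nA /AB. Qed.

Lemma topen_tinterior A : topen (tinterior A).
Proof.
by move=> t [n nA]; exists n => u e; exists n => v; rewrite e; apply: nA.
Qed.

Lemma sub_tclosure A : A `<=` tclosure A.
Proof. by move=> t At /tinterior_sub. Qed.

Lemma tclosed_tclosure A : tclosed (tclosure A).
Proof. by rewrite /tclosed /tclosure setCK; apply: topen_tinterior. Qed.

Lemma tclosure_min A B : tclosed B -> A `<=` B -> tclosure A `<=` B.
Proof.
move=> cB AB t At; apply: contrapT => /cB nBt; apply: At.
by apply: tinteriorS nBt => u Bu /AB.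
Qed.

Lemma topenT : topen setT.
Proof. by move=> t _; exists 0. Qed.

Lemma topenU A B : topen A -> topen B -> topen (A `|` B).
Proof.
move=> oA oB t [/oA|/oB]; apply: tinteriorS => u; [by left | by right].
Qed.

Lemma topenI A B : topen A -> topen B -> topen (A `&` B).
Proof.
move=> oA oB t [/oA[m mA] /oB[n nB]]; exists (maxn m n) => u e; split.
  by apply: mA; apply: mkseq_le e; apply: leq_maxl.
by apply: nB; apply: mkseq_le e; apply: leq_maxr.
Qed.

Lemma topen_bigcup (I : Type) (A : I -> set (trace D)) :
  (forall i, topen (A i)) -> topen (\bigcup_i A i).
Proof. by move=> oA t [i _ /oA]; apply: tinteriorS => u; exists i. Qed.

(** Serves both modalities, [Box] by way of its complement. One letter more than for the tail also
    fixes the value tested by [P]. *)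
Lemma topen_head_tail (P : pred D) A : topen A ->
  topen [set t | P (t 0) /\ A (ttail t)].
Proof.
by move=> oA t [Pt /oA[n nA]]; exists n.+1 => u /mkseq_ttail[/= -> /nA].
Qed.

Lemma topen_monitorable A : topen A ->
  exists P : seq D -> Prop, (forall w w', P w -> P (w ++ w')) /\
    forall t, (exists n, P (mkseq t n)) <-> A t.
Proof.
(* Lengthening [w] shrinks the set of its infinite extensions, so the predicate persists. *)
move=> oA; exists (fun w => forall u, mkseq u (size w) = w -> A u); split.
  move=> w w' wA u e; apply: wA.
  move/(congr1 (take (size w))): e; rewrite take_size_cat //.
  rewrite size_cat /mkseq -map_take take_iota.
  by rewrite (minn_idPl _) // leq_addr.
move=> t; split=> [[n nA]|/oA[n nA]]; first by apply: nA; rewrite size_mkseq.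
by exists n => u; rewrite size_mkseq; apply: nA.
Qed.

End PrefixTopology.

Section FixedPoints.
Variables (D : eqType) (DVar : choiceType).
Notation interp := (dinterp D DVar).
Variable Phi : interp -> interp.
Hypothesis Phi_mono : forall F G, dinterp_le F G -> dinterp_le (Phi F) (Phi G).

Lemma dinterp_le_anti (F G : interp) :
  dinterp_le F G -> dinterp_le G F -> F = G.
Proof. by move=> FG GF; apply: funext => d; apply/seteqP; split. Qed.

(** Knaster-Tarski: the intersection [L] of all pre-fixed points is the least fixed point. This
    turns membership in a [Min] formula into an induction principle. *)
Lemma lfpP delta t : (exists F, is_lfp Phi F /\ F delta t) <->
  forall G, dinterp_le (Phi G) G -> G delta t.
Proof.
pose L : interp := fun d => [set u | forall G, dinterp_le (Phi G) G -> G d u].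
have L_le G : dinterp_le (Phi G) G -> dinterp_le L G.
  by move=> PG d u; apply.
have PL : dinterp_le (Phi L) L.
  by move=> d u Pu G PG; apply/PG/(Phi_mono (L_le _ PG)).
have fixL : Phi L = L by apply: dinterp_le_anti => //; apply: L_le; apply: Phi_mono.
have lfpL : is_lfp Phi L by split=> // G PG; apply: L_le => d u; rewrite PG.
split=> [[F [[_ minF] Ft]]|Lt]; last by exists L.
(* [is_lfp] compares [F] with fixed points only, hence the detour through [L]. *)
exact: minF fixL _ _ Ft.
Qed.

(** Dually, the union [M] of all post-fixed points is the greatest fixed point; this yields
    coinduction. *)
Lemma gfpP delta t : (exists F, is_gfp Phi F /\ F delta t) <->
  exists G, dinterp_le G (Phi G) /\ G delta t.
Proof.
pose M : interp := fun d => [set u | exists G, dinterp_le G (Phi G) /\ G d u].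
have le_M G : dinterp_le G (Phi G) -> dinterp_le G M.
  by move=> GP d u Gu; exists G.
have MP : dinterp_le M (Phi M).
  by move=> d u [G [GP Gu]]; apply/(Phi_mono (le_M _ GP))/GP.
have fixM : Phi M = M by apply: dinterp_le_anti => //; apply: le_M; apply: Phi_mono.
have gfpM : is_gfp Phi M by split=> // G PG; apply: le_M => d u; rewrite PG.
split=> [[F [[fixF _] Ft]]|Mt]; last by exists M.
by exists F; split=> // d u; rewrite fixF.
Qed.

Lemma topen_lfp :
  (forall F, (forall d, topen (F d)) -> forall d, topen (Phi F d)) ->
  forall delta, topen [set t | exists F, is_lfp Phi F /\ F delta t].
Proof.
set L : interp := fun d => [set t | exists F, is_lfp Phi F /\ F d t].
move=> oPhi delta t /lfpP/(_ (fun d => tinterior (L d))); apply=> d u.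
move/(oPhi _ (fun d => @topen_tinterior _ (L d))); apply: tinteriorS => v Pv.
(* Any pre-fixed point [G] contains [L], hence its interior, so [Phi] of that interior lies below
   [Phi G] and thus below [G]. *)
apply/lfpP => G PG; apply: (PG); apply: Phi_mono Pv => d' w.
by move=> /tinterior_sub/lfpP/(_ _ PG).
Qed.

Lemma tclosed_gfp :
  (forall F, (forall d, tclosed (F d)) -> forall d, tclosed (Phi F d)) ->
  forall delta, tclosed [set t | exists F, is_gfp Phi F /\ F delta t].
Proof.
set M : interp := fun d => [set t | exists F, is_gfp Phi F /\ F d t].
move=> cPhi delta t nMt; apply: contrapT => clMt; apply: nMt.
(* Coinduction with the closure of [M], which contains [t] by [clMt]. It is a post-fixed point
   because its image under [Phi] is closed and contains [M]. *)
apply/gfpP; exists (fun d => tclosure (M d)); split=> // d.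
apply: tclosure_min; first by apply: cPhi => d'; apply: tclosed_tclosure.
move=> u /gfpP[G [GP Gu]]; apply: Phi_mono (GP _ _ Gu) => d' v Gv.
by apply/sub_tclosure/gfpP; exists G.
Qed.

End FixedPoints.

Section Formulae.
Variables (D : eqType) (DVar FVar : choiceType).
Implicit Types (phi : formula DVar FVar) (rho : tenv D DVar FVar).

(** Negation occurs only inside constraints, never above a recursion variable. The result supplies
    the monotonicity that [lfpP] and [gfpP] require. *)
Lemma sem_mono phi rho rho' : (forall X, dinterp_le (rho X) (rho' X)) ->
  dinterp_le (sem phi rho) (sem phi rho').
Proof.
have upd r r' X (F F' : dinterp D DVar) : (forall Y, dinterp_le (r Y) (r' Y)) ->
    dinterp_le F F' -> forall Y : FVar,
    dinterp_le ([eta r with X |-> F] Y) ([eta r' with X |-> F'] Y).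
  by move=> rr' FF' Y /=; case: eqP.
elim: phi rho rho' => [||b p IH|b p IH|x p IH|x p IH|p IHp q IHq|p IHp q IHq
  |X p IH|X p IH|X] rho rho' le_rho delta t //=.
- by case=> ? pt; split=> //; apply: IH pt.
- by move=> pt /pt; apply: IH.
- by case=> d _ pt; exists d => //; apply: IH pt.
- by move=> pt d _; apply: IH (pt d I).
- by case=> [/(IHp _ _ le_rho)|/(IHq _ _ le_rho)]; [left | right].
- by case=> /(IHp _ _ le_rho) ? /(IHq _ _ le_rho).
- have mono r (F G : dinterp D DVar) : dinterp_le F G ->
      dinterp_le (sem p [eta r with X |-> F]) (sem p [eta r with X |-> G]).
    by move=> FG; apply: IH; apply: upd FG => Y d u.
  (* A pre-fixed point for the larger [rho'] is also one for [rho]. *)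
  move/(lfpP (@mono rho)) => pt; apply/(lfpP (@mono rho')) => G PG.
  by apply: pt => d u pu; apply: PG; apply: IH pu; apply: upd => // d' v.
- have mono r (F G : dinterp D DVar) : dinterp_le F G ->
      dinterp_le (sem p [eta r with X |-> F]) (sem p [eta r with X |-> G]).
    by move=> FG; apply: IH; apply: upd FG => Y d u.
  (* A post-fixed point for [rho] is also one for [rho']. *)
  move/(gfpP (@mono rho)) => [G [GP Gt]]; apply/(gfpP (@mono rho')); exists G.
  by split=> // d u /GP; apply: IH; apply: upd => // d' v.
- exact: le_rho.
Qed.

Lemma sem_upd_mono phi rho X (F G : dinterp D DVar) : dinterp_le F G ->
  dinterp_le (sem phi [eta rho with X |-> F]) (sem phi [eta rho with X |-> G]).
Proof. by move=> FG; apply: sem_mono => Y /=; case: eqP => // _ d t. Qed.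

(** Bodies of fixed points have free recursion variables, so the induction ranges over all
    environments with open values. *)
Lemma topen_sem phi rho : cHML phi -> (forall X delta, topen (rho X delta)) ->
  forall delta, topen (sem phi rho delta).
Proof.
elim: phi rho => [||b p IH|b p IH|x p IH|x p IH|p IHp q IHq|p IHp q IHq
  |X p IH|X p IH|X] rho //=.
- by move=> _ _ _; apply: topenT.
- move=> cp orho delta.
  by apply: (topen_head_tail (P := fun d => holds delta d b)); apply: IH.
- by move=> cp orho delta; apply: topen_bigcup => d; apply: IH.
- by case/andP=> cp cq orho delta; apply: topenU; [apply: IHp | apply: IHq].
- by case/andP=> cp cq orho delta; apply: topenI; [apply: IHp | apply: IHq].
- move=> cp orho; apply: topen_lfp => [F G|F oF]; first exact: sem_upd_mono.
  by apply: IH => // Y /=; case: eqP.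
Qed.

Lemma tclosed_sem phi rho : sHML phi -> (forall X delta, tclosed (rho X delta)) ->
  forall delta, tclosed (sem phi rho delta).
Proof.
elim: phi rho => [||b p IH|b p IH|x p IH|x p IH|p IHp q IHq|p IHp q IHq
  |X p IH|X p IH|X] rho //=.
- by move=> _ _ _; rewrite /tclosed setC0; apply: topenT.
- move=> sp crho delta; rewrite /tclosed.
  (* The complement of a box is the diamond of the complement. *)
  have -> : ~` [set t | holds delta (t 0) b -> sem p rho delta (ttail t)] =
      [set t | holds delta (t 0) b /\ (~` sem p rho delta) (ttail t)].
    by apply/seteqP; split=> t /= /not_implyP.
  by apply: (topen_head_tail (P := fun d => holds delta d b)); apply: IH.
- move=> sp crho delta; rewrite /tclosed setC_bigcap.
  by apply: topen_bigcup => d; apply: IH.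
- case/andP=> sp sq crho delta; rewrite /tclosed setCU.
  by apply: topenI; [apply: IHp | apply: IHq].
- case/andP=> sp sq crho delta; rewrite /tclosed setCI.
  by apply: topenU; [apply: IHp | apply: IHq].
- move=> sp crho; apply: tclosed_gfp => [F G|F cF]; first exact: sem_upd_mono.
  by apply: IH => // Y /=; case: eqP.
Qed.

End Formulae.

Theorem theorem16 (D : eqType) (DVar FVar : choiceType)
    (hD : countably_infinite D)
    (hDVar : countably_infinite DVar)
    (hFVar : countably_infinite FVar) :
  (forall phi : formula DVar FVar,
     cHML phi -> closed_formula phi -> guarded_formula phi ->
     monitorable_for_satisfactions D phi) /\
  (forall phi : formula DVar FVar,
     sHML phi -> closed_formula phi -> guarded_formula phi ->
     monitorable_for_violations D phi).
Proof.
split=> phi frag _ _.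
  (* The environment fixed in [sem_closed] has empty values, which are open, and also closed as
     needed for violations. *)
  have oA : topen (@sem_closed D _ _ phi) by apply: topen_sem => // X delta t [].
  have [P [Pcat PE]] := topen_monitorable oA.
  (* The monitor gives a single verdict: it never rejects here, and never accepts in the case of
     violations. *)
  have PN w : ~ (P w /\ False) by case.
  by exists (Monitor PN Pcat (fun _ _ => id)).
have cA : tclosed (@sem_closed D _ _ phi).
  by apply: tclosed_sem => // X delta; rewrite /tclosed setC0; apply: topenT.
have [P [Pcat PE]] := topen_monitorable cA.
have PN w : ~ (False /\ P w) by case.
by exists (Monitor PN (fun _ _ => id) Pcat).
Qed.
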